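(* Let $S$ be a numerical semigroup with embedding dimension $\mathrm{e}(S)=2$, so $S=\langle a,b\rangle$ for integers $a,b>1$ with $\gcd(a,b)=1$, and let $m$ be a positive integer. Then $\mathrm{H}(S)$ is equidistributed modulo $m$ if and only if $\gcd(ab,m)=1$ and at least one of the following holds: (1) $a\equiv1\pmod m$; or (2) $b\equiv1\pmod m$.
   Context: A numerical semigroup is a submonoid $S$ of $(\mathbb{N}_0,+)$ with finite complement; $\mathrm{H}(S)=\mathbb{N}_0\setminus S$ is its set of gaps. $\langle a,b\rangle$ is the set of all $\mathbb{N}_0$-linear combinations of $a$ and $b$. The embedding dimension $\mathrm{e}(S)$ is the cardinality of the unique minimal generating set of $S$. A finite (multi)set of integers is equidistributed modulo $m$ if it contains the same number of elements in each congruence class modulo $m$. *)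

(* Defs.v *)
From mathcomp Require Import all_boot.
From mathcomp Require Import boolp classical_sets functions cardinality.
From mathcomp Require Import finmap.

Set Implicit Arguments.
Unset Strict Implicit.
Unset Printing Implicit Defensive.

Local Open Scope classical_set_scope.
Local Open Scope card_scope.

Definition submonoid (S : set nat) : Prop :=
  S 0 /\ forall x y, S x -> S y -> S (x + y).

Definition gaps (S : set nat) : set nat := ~` S.

Definition numerical_semigroup (S : set nat) : Prop :=
  submonoid S /\ finite_set (gaps S).

Definition generates (A S : set nat) : Prop := smallest submonoid A = S.

Definition minimal_generating_set (S A : set nat) : Prop :=
  generates A S /\ forall B, B `<=` A -> generates B S -> B = A.

(* A numerical semigroup has exactly one minimal generating set, and it is
   finite, so neither default ([set0] for [xget], the empty [fset_set] of an
   infinite set) is ever used there. *)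
Definition embdim (S : set nat) : nat :=
  #|` fset_set (xget set0 (minimal_generating_set S))|.

Definition gen2 (a b : nat) : set nat :=
  [set n | exists x y : nat, n = x * a + y * b].

(* Intended for finite [A] and [0 < m]; every residue class modulo [m] is then
   the class of some natural number. *)
Definition equidistributed_mod (A : set nat) (m : nat) : Prop :=
  forall i j : nat,
    [set x | A x /\ x = i %[mod m]] #= [set x | A x /\ x = j %[mod m]].

(* Main.v *)
(* Let H(x) be the generating polynomial of the gaps of <a,b>. The Apery set of
   <a,b> with respect to b is {0, a, ..., (b-1)a}, so
     (1 - x^b) H(x) = (1 + x + ... + x^(b-1)) - (1 + x^a + ... + x^((b-1)a)).
   Reduce modulo x^m - 1. Equidistribution kills the left-hand side, so
   {0, ..., b-1} and {0, a, ..., (b-1)a} agree as multisets of residues modulo m.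
   As 1 < b, some multiple of a is 1 modulo m, whence gcd(a,m) = 1, and
   gcd(b,m) = 1 by symmetry. Multiplying the equality of multisets by
   (1 - x)(1 - x^a) turns it into (1 - x^a)(1 - x^b) = (1 - x)(1 - x^(ab)), and
   comparing one coefficient gives a = 1 or b = 1 modulo m. Conversely, if
   a = 1 modulo m the two multisets agree, so the gap counts are invariant under
   translation by b, a generator of Z/m. *)

Require Import Defs.
From mathcomp Require Import all_boot.
From mathcomp Require Import classical_sets.
From mathcomp Require Import boolp cardinality finmap zify.

Set Implicit Arguments.
Unset Strict Implicit.
Unset Printing Implicit Defensive.

Definition congr_nat (m k n : nat) : nat := k == n %[mod m].

(* [n] is a gap of <a,b> lying below the Apery element [j * a] of its class
   modulo [b]; every gap arises for exactly one [j < b]. *)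
Definition gap_at (a b j n : nat) : bool := (n < j * a) && (n == j * a %[mod b]).

(** Every gap lies below [j * a] for some [j < b], so the bound [a * b] loses none. *)
Definition gap_count (a b m i : nat) : nat :=
  \sum_(j < b) \sum_(n < a * b) gap_at a b j n * congr_nat m n i.

Definition mul_count (a b m i : nat) : nat :=
  \sum_(j < b) congr_nat m (j * a) i.

Lemma congr_natDr m k n d : congr_nat m (k + d) (n + d) = congr_nat m k n.
Proof. by rewrite /congr_nat eqn_modDr. Qed.

Lemma congr_nat_period m k n t : congr_nat m k (n + t * m) = congr_nat m k n.
Proof. by rewrite /congr_nat addnC modnMDl. Qed.

Lemma mul_count_period a b m i t :
  mul_count a b m (i + t * m) = mul_count a b m i.
Proof. by apply: eq_bigr => j _; rewrite congr_nat_period. Qed.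

(** Coefficient of x^(i+a) in (1 - x^a)(1 + x^a + ... + x^((b-1)a)) = 1 - x^(ab) modulo x^m - 1,
    with negative terms moved across to stay in [nat]. *)
Lemma mul_count_shift a b m i :
  mul_count a b m (i + a) + congr_nat m (b * a) (i + a) =
  mul_count a b m i + congr_nat m 0 (i + a).
Proof.
rewrite /mul_count; transitivity (\sum_(j < b.+1) congr_nat m (j * a) (i + a)).
  by rewrite big_ord_recr.
rewrite big_ord_recl /= mul0n addnC; congr (_ + _).
by apply: eq_bigr => j _; rewrite /= /bump /= add1n mulSnr congr_natDr.
Qed.

Lemma coprime_mod_surj a b n : 0 < b -> coprime a b ->
  exists2 j, j < b & j * a = n %[mod b].
Proof.
move=> b0 cab.
have [k _ /dvdnP [q Hq]] := Bezoutl a b0.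
have {}Hq : 1 + k * a = q * b by rewrite -Hq gcdnC; move/eqP: cab => ->.
(* Here [k * a] is -1 modulo [b] and [b - 1] stands for -1, so the signs cancel. *)
exists ((n * (b - 1) * k) %% b); first by rewrite ltn_mod.
rewrite modnMml.
have -> : n * (b - 1) * k * a = (n * (b - 1)) * (k * a) by rewrite !mulnA.
have : n * (b-1) * (k * a) + n * (b - 1) = n + n * (b - 1) %[mod b].
  have -> : n * (b-1) * (k * a) + n * (b - 1) = (n * (b - 1) * q) * b
    by rewrite -[RHS]mulnA -Hq mulnDr muln1 addnC.
  have -> : n + n * (b - 1) = n * b by nia.
  by rewrite !modnMl.
by move/eqP; rewrite eqn_modDr => /eqP.
Qed.

Lemma coprime_mod_inj a b j k : coprime a b -> j < b -> k < b ->
  j * a = k * a %[mod b] -> j = k.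
Proof.
move=> cab; wlog lejk : j k / j <= k => [H|] jb kb E.
  by case/orP: (leq_total j k) => h; [apply: H | apply/esym/H].
move/esym/eqP: E; rewrite eqn_mod_dvd ?leq_mul2r ?lejk ?orbT //.
rewrite -mulnBl Gauss_dvdl 1?coprime_sym // => D.
by case: (posnP (k - j)) => [|p]; [lia | have := dvdn_leq p D; lia].
Qed.

Lemma coprime_mod_sum a b n : 0 < b -> coprime a b ->
  \sum_(j < b) (n == j * a %[mod b] : nat) = 1.
Proof.
move=> b0 cab; have [j jb Ej] := @coprime_mod_surj a b n b0 cab.
rewrite (bigD1 (Ordinal jb)) //= Ej eqxx big1 // => k nk.
case: eqP => // E; case/eqP: nk; apply: val_inj => /=.
by apply: (@coprime_mod_inj a b) => //; rewrite -E.
Qed.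

(** Only the [j] with [j * a = n] modulo [b] can contribute, and [j * a] is the least element of
    <a,b> in that class. *)
Lemma gap_at_gen2 a b n : 0 < b -> coprime a b ->
  \sum_(j < b) (gap_at a b j n : nat) = ~~ `[< gen2 a b n >].
Proof.
move=> b0 cab; have [j jb Ej] := @coprime_mod_surj a b n b0 cab.
rewrite (bigD1 (Ordinal jb)) //= /gap_at Ej eqxx andbT big1 ?addn0; last first.
  move=> k nk; case: eqP => [E|]; last by rewrite andbF.
  case/eqP: nk; apply: val_inj => /=.
  by apply: (@coprime_mod_inj a b) => //; rewrite -E.
congr nat_of_bool; rewrite ltnNge; congr negb; apply/idP/asboolP => [le|[x [y En]]].
  move/esym/eqP: Ej; rewrite eqn_mod_dvd // => /dvdnP [q Eq].
  by exists j, q; lia.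
have xj : (x %% b) * a = j * a %[mod b].
  by rewrite Ej En modnMml addnC modnMDl.
have <- := @coprime_mod_inj a b _ _ cab _ jb xj; last by rewrite ltn_mod.
by rewrite En; have := leq_mod x b; nia.
Qed.

Lemma card_eq_bounded (P : pred nat) N : (forall x, P x -> x < N) ->
  ([set x | P x] #= `I_(\sum_(n < N) P n))%card.
Proof.
move=> PN; have -> : [set x | P x]%classic = [set` [fset x in filter P (iota 0 N)]%fset]%classic.
  apply/seteqP; split => x /=; rewrite !inE mem_filter mem_iota /=.
    by move=> Px; rewrite Px /= add0n PN.
  by case/andP.
apply/card_eq_fsetP; rewrite card_fseq undup_id ?filter_uniq ?iota_uniq //.
rewrite size_filter -sum1_count -(big_mkord xpredT (fun n => P n : nat)) /index_iota subn0.
by rewrite big_mkcond /=; apply: eq_bigr => n _; case: (P n).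
Qed.

Lemma card_gaps_congr a b m i : 0 < b -> coprime a b ->
  ([set x | gaps (gen2 a b) x /\ x = i %[mod m]] #= `I_(gap_count a b m i))%card.
Proof.
move=> b0 cab.
pose P := fun x => ~~ `[< gen2 a b x >] && (x == i %[mod m]).
have -> : [set x | gaps (gen2 a b) x /\ x = i %[mod m]]%classic = [set x | P x]%classic.
  apply/seteqP; split => x /=.
    by case=> gx Ex; apply/andP; split; [apply/asboolPn|apply/eqP].
  by case/andP=> /asboolPn gx /eqP Ex.
have -> : gap_count a b m i = \sum_(n < a * b) P n.
  rewrite /gap_count exchange_big /=; apply: eq_bigr => n _.
  rewrite -big_distrl /= gap_at_gen2 // /congr_nat /P.
  by case: (~~ _); case: (_ == _).
apply: card_eq_bounded => x /andP[gx _].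
have : 0 < \sum_(j < b) (gap_at a b j x : nat) by rewrite gap_at_gen2 // gx.
rewrite lt0n sum_nat_eq0 negb_forall => /existsP[j].
rewrite /= eqb0 negbK => /andP[lt _].
by apply: leq_trans lt _; rewrite mulnC leq_mul2l ltnW ?ltn_ord ?orbT.
Qed.

(** For each [j], the gaps below [j * a] in its class modulo [b] are r, r + b, ..., ja - b, where r
    = ja mod b. Translation by [b] trades r for ja. *)
Lemma gap_count_shift a b m i : 0 < b -> coprime a b ->
  gap_count a b m (i + b) + mul_count a b m (i + b) =
  mul_count 1 b m (i + b) + gap_count a b m i.
Proof.
move=> b0 cab.
(* Each residue [n < b] is assigned to its unique [j], so that the identity can be checked for one
   [j] at a time. *)
have -> : mul_count 1 b m (i + b) =
    \sum_(j < b) \sum_(n < b) (n == j * a %[mod b]) * congr_nat m n (i + b).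
  rewrite exchange_big; apply: eq_bigr => n _.
  by rewrite -big_distrl /= coprime_mod_sum // mul1n muln1.
rewrite -!big_split /=; apply: eq_bigr => j _.
have jab : j * a < a * b + b.
  by have := ltn_ord j; nia.
pose F n := gap_at a b j n * congr_nat m n (i + b).
(* The added terms vanish. The longer range splits into [n < b], which yields r, and the numbers
   [b + n], which yield the translated gaps. *)
have {1}-> : \sum_(n < a * b) gap_at a b j n * congr_nat m n (i + b)
    = \sum_(n < b + a * b) F n.
  rewrite (addnC b (a * b)) big_split_ord /= [X in _ = _ + X]big1 ?addn0 // => n _.
  by rewrite /F /gap_at; have := ltn_ord j; case: ltnP; rewrite //=; nia.
have -> : congr_nat m (j * a) (i + b) =
    \sum_(n < b + a * b) (n == j * a :> nat) * congr_nat m n (i + b).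
  have jab' : j * a < b + a * b by rewrite addnC.
  rewrite (bigD1 (Ordinal jab')) //= eqxx mul1n big1 ?addn0 // => n nj.
  case: (nat_of_ord n =P j * a) => // E; case/eqP: nj; exact: val_inj.
rewrite -big_split big_split_ord /=; congr (_ + _); apply: eq_bigr => n _ /=.
  rewrite /F -mulnDl; congr (_ * _); rewrite /gap_at.
  have nb := ltn_ord n.
  case: (ltngtP n (j * a)) => //= [_|lt|E]; [by rewrite addn0| |by rewrite E eqxx].
  apply/esym/eqP; rewrite eqb0; apply/negP.
  rewrite eqn_mod_dvd ?(ltnW lt) // => D.
  by have := dvdn_leq _ D; rewrite subn_gt0 => /(_ lt); lia.
rewrite /F -mulnDl (addnC b) congr_natDr; congr (_ * _); rewrite /gap_at modnDr.
case: (n %% b =P j * a %% b) => [E|nE] /=; rewrite ?andbT ?andbF.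
  case: (ltnP n (j * a)) => lt.
    move/esym/eqP: E; rewrite eqn_mod_dvd ?(ltnW lt) // => D.
    by have := dvdn_leq _ D; rewrite subn_gt0 => /(_ lt); lia.
  lia.
case: eqP => // E; case: nE; by rewrite -E modnDr.
Qed.

Lemma equidistributed_gapsP a b m : 0 < b -> coprime a b ->
  equidistributed_mod (gaps (gen2 a b)) m <->
  forall i j, gap_count a b m i = gap_count a b m j.
Proof.
move=> b0 cab; split=> H i j; have := H i j;
  rewrite (card_eql (card_gaps_congr m i b0 cab)) (card_eqr (card_gaps_congr m j b0 cab)).
  by move/card_eq_II.
by move=> E; apply/card_eq_II.
Qed.

Lemma equidistributed_mul_count a b m : 0 < b -> 0 < m -> coprime a b ->
  equidistributed_mod (gaps (gen2 a b)) m ->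
  forall i, mul_count a b m i = mul_count 1 b m i.
Proof.
move=> b0 m0 cab /(equidistributed_gapsP m b0 cab) H i.
(* Adding [b * m] preserves the class of [i] modulo [m] and prevents truncation when [b] is
   subtracted. *)
have := @gap_count_shift a b m (i + b * m - b) b0 cab.
rewrite subnK; last by nia.
rewrite !mul_count_period (H _ (i + b * m - b)); lia.
Qed.

Lemma mul_count_coprime a b m : 1 < b ->
  (forall i, mul_count a b m i = mul_count 1 b m i) -> coprime a m.
Proof.
move=> b1 H.
have : mul_count 1 b m 1 != 0.
  rewrite -lt0n /mul_count (bigD1 (Ordinal b1)) //= mul1n.
  by rewrite /congr_nat eqxx.
rewrite -H sum_nat_eq0 negb_forall => /existsP[j]; rewrite /= eqb0 negbK => /eqP E.
have : coprime (j * a) m by rewrite -coprime_modl E coprime_modl coprime1n.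
by rewrite coprimeMl => /andP[].
Qed.

Lemma mul_count_eq_congr1 a b m : 0 < m -> coprime a m -> coprime b m ->
  (forall i, mul_count a b m i = mul_count 1 b m i) ->
  a = 1 %[mod m] \/ b = 1 %[mod m].
Proof.
move=> m0 cam cbm H.
(* E1 - E2 - E3 + E4 is the coefficient of x^(m - 1 + a + 1) in
   (1 - x^a)(1 - x^b) = (1 - x)(1 - x^(ab)). *)
have E1 := mul_count_shift 1 b m (m.-1 + a).
have E2 := mul_count_shift 1 b m m.-1.
have E3 := mul_count_shift a b m (m.-1 + 1).
have E4 := mul_count_shift a b m m.-1.
rewrite !H !muln1 in E1 E2 E3 E4.
have Em : m.-1 + 1 = m by lia.
rewrite (addnAC m.-1 a 1) in E1; rewrite Em in E1 E2 E3.
have c0 : congr_nat m 0 m = 1 by rewrite /congr_nat modnn mod0n.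
(* The term -x^a on the left must cancel against x^(a+b), so b = 0 and coprimality forces m = 1, or
   match -x or -x^(ab) on the right, so a = 1 or ab = a modulo [m]. *)
have : congr_nat m 0 (m.-1 + a) + congr_nat m b m + congr_nat m (b * a) (m + a) > 0 by lia.
rewrite !addn_gt0 !lt0b -orbA => /or3P[]; rewrite ?modnDl ?modnn => /eqP E.
- left; apply/eqP; rewrite -(eqn_modDl m.-1) -E Em modnn mod0n; exact/eqP.
- right; have : coprime (b %% m) m by rewrite coprime_modl.
  by rewrite E /coprime gcd0n => /eqP ->; rewrite !modn1.
- right; apply: (coprime_mod_inj cam); rewrite ?ltn_mod //.
  by rewrite !modnMml mul1n E.
Qed.

Lemma gen2C a b : gen2 a b = gen2 b a.
Proof.
by apply/seteqP; split => n [x [y ->]]; exists y, x; rewrite addnC.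
Qed.

Lemma equidistributed_congr1 a b m : 0 < b -> 0 < m -> coprime a b -> coprime b m ->
  a = 1 %[mod m] -> equidistributed_mod (gaps (gen2 a b)) m.
Proof.
move=> b0 m0 cab cbm a1; apply/equidistributed_gapsP => //.
have mE i : mul_count a b m i = mul_count 1 b m i.
  by apply: eq_bigr => j _; rewrite /congr_nat -modnMmr a1 modnMmr.
have step i : gap_count a b m (i + b) = gap_count a b m i.
  by have := gap_count_shift m i b0 cab; rewrite mE; lia.
have steps i k : gap_count a b m (i + k * b) = gap_count a b m i.
  by elim: k => [|k IH]; rewrite ?addn0 // mulSnr addnA step.
have per i j : i = j %[mod m] -> gap_count a b m i = gap_count a b m j.
  move=> E; apply: eq_bigr => k _; apply: eq_bigr => n _.
  by rewrite /congr_nat E.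
(* The multiple [k * b] represents j - i modulo [m], with [m - 1] in the role of -1. *)
move=> i j; have [k _ Ek] := @coprime_mod_surj b m (j + i * (m - 1)) m0 cbm.
rewrite -(steps i k); apply: per; rewrite -modnDmr Ek modnDmr.
have -> : i + (j + i * (m - 1)) = i * m + j by nia.
by rewrite modnMDl.
Qed.

Theorem corollary5p8 (S : set nat)
    (hS : numerical_semigroup S) (heS : embdim S = 2)
    (a b : nat) (ha : 1 < a) (hb : 1 < b) (hab : gcdn a b = 1)
    (hgen : S = gen2 a b)
    (m : nat) (hm : 0 < m) :
  equidistributed_mod (gaps S) m <->
  gcdn (a * b) m = 1 /\ (a = 1 %[mod m] \/ b = 1 %[mod m]).
Proof.
have cab : coprime a b by apply/eqP.
have cba : coprime b a by rewrite coprime_sym.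
have a0 := ltnW ha; have b0 := ltnW hb.
rewrite {}hgen; split=> [H|[/eqP]].
  have Hab := equidistributed_mul_count b0 hm cab H.
  have cam := mul_count_coprime hb Hab.
  have cbm : coprime b m.
    rewrite gen2C in H.
    exact: mul_count_coprime ha (equidistributed_mul_count a0 hm cba H).
  split; last exact: mul_count_eq_congr1 hm cam cbm Hab.
  by apply/eqP; rewrite -/(coprime _ _) coprimeMl cam.
rewrite -/(coprime _ _) coprimeMl => /andP[cam cbm] [a1|b1].
  exact: equidistributed_congr1.
by rewrite gen2C; apply: equidistributed_congr1.
Qed.
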